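(* Let $A=(a_{ij})\in\mathbb{R}^{n\times n}$, let $\phi:\mathbb{R}^n\to\mathbb{R}^n$ be an elementary transformation, and let $\dot y = h(y)$, with $h(y)=D\phi_{\phi^{-1}(y)}A\,\phi^{-1}(y)$, be the system obtained from the linear system $\dot x = Ax$ by the change of variables $y=\phi(x)$. Then: (1) There exist a polynomial $p:\mathbb{R}^n\to\mathbb{R}$ and a lift $\tilde h:\mathbb{R}^{n+1}\to\mathbb{R}^{n+1}$ of $h$ by $p$ such that $\tilde h\in\mathcal{W}_{n+1}$. (2) If $a_{in}=0$ for all $i\neq n$, then $h\in\mathcal{W}_n$.
   Context: For a vector field $f$ on $\mathbb{R}^n$, $e^{tf}x_0$ denotes the value at time $t$ of the solution of $\dot x = f(x)$, $x(0)=x_0$. For $m\ge n$, $\Pi_n:\mathbb{R}^m\to\mathbb{R}^n$ is the projection on the first $n$ coordinates. $D\phi_x$ is the Jacobian matrix of $\phi$ at $x$. An elementary transformation of $\mathbb{R}^n$ is a map $x\mapsto (x_1,\ldots,x_{n-1},x_n+g(x_1,\ldots,x_{n-1}))$ with $g$ a real polynomial of degree greater than 1; its inverse is $y\mapsto(y_1,\ldots,y_{n-1},y_n-g(y_1,\ldots,y_{n-1}))$. Lift: given polynomial maps $f:\mathbb{R}^n\to\mathbb{R}^n$ and $p:\mathbb{R}^n\to\mathbb{R}^k$, a polynomial vector field $\tilde f:\mathbb{R}^{n+k}\to\mathbb{R}^{n+k}$ is a lift of $f$ by $p$ if for all $x_0\in\mathbb{R}^n$ and all $t\ge 0$, $\Pi_n(e^{t\tilde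 f}z_0)=e^{tf}x_0$ where $z_0=(x_0,p(x_0))$. The vector field $f$ is super-linearizable if for some $k$ and some polynomial $p$ it has a lift by $p$ of the linear form $\tilde f(z)=Bz$, $B\in\mathbb{R}^{(n+k)\times(n+k)}$. Weighted dependency graph (WDG): to a polynomial vector field $f$ on $\mathbb{R}^n$ associate the directed graph on nodes $v_1,\ldots,v_n$ with edge set $\{v_iv_j : \partial f_i/\partial x_j \not\equiv 0\}$ (self-loops allowed), the edge $v_iv_j$ having weight the polynomial $\partial f_i/\partial x_j$. $f$ satisfies the WDG condition if, for every directed cycle (including self-loops) of this graph, the product of the edge weights along the cycle is a constant. $\mathcal{W}_n$ is the set of super-linearizable polynomial vector fields on $\mathbb{R}^n$ that satisfy the WDG condition. *)

(* Defs.v *)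
From HB Require Import structures.
From mathcomp Require Import all_boot all_order all_algebra.
From mathcomp Require Import reals normedtype derive.
(* The notations of mpoly clash with those of mathcomp-analysis. *)
From mathcomp Require Import -(notations) mpoly.
Import Order.TTheory GRing.Theory Num.Theory.
Import numFieldNormedType.Exports.

Set Implicit Arguments.
Unset Strict Implicit.
Unset Printing Implicit Defensive.

Local Open Scope ring_scope.

Notation "{ 'mpoly' T [ n ] }" := (mpoly n T)
  (at level 0, T, n at level 2, format "{ 'mpoly'  T [ n ] }") : type_scope.

(* Points of R^n are column vectors x : 'cV[R]_n, and a polynomial map from
   R^n to R^k is a column p : 'cV[{mpoly R[n]}]_k of polynomials. *)

Section PolynomialMaps.
Variable R : comNzRingType.

Definition mxeval n k l (x : 'cV[R]_n) (M : 'M[{mpoly R[n]}]_(k, l)) :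
  'M[R]_(k, l) := map_mx (meval (fun i => x i 0)) M.

Definition mxcomp n m k l (q : 'cV[{mpoly R[n]}]_m)
  (M : 'M[{mpoly R[m]}]_(k, l)) : 'M[{mpoly R[n]}]_(k, l) :=
  map_mx (comp_mpoly [tuple q i 0 | i < m]) M.

Definition idmap n : 'cV[{mpoly R[n]}]_n := \col_i mpolyX R (mnm1 i).

Definition mxconst n k l (M : 'M[R]_(k, l)) : 'M[{mpoly R[n]}]_(k, l) :=
  map_mx (@mpolyC n R) M.

Definition linear_field n (B : 'M[R]_n) : 'cV[{mpoly R[n]}]_n :=
  mxconst n B *m idmap n.

Definition jacobian n k (p : 'cV[{mpoly R[n]}]_k) : 'M[{mpoly R[n]}]_(k, n) :=
  \matrix_(i, j) mderiv j (p i 0).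

(* msize is the degree plus one (and 0 for the zero polynomial). *)
Definition mdegree n (p : {mpoly R[n]}) : nat := (msize p).-1.

(* x |-> (x_1, ..., x_m, x_(m+1) + g(x_1, ..., x_m)) *)
Definition elementary m (g : {mpoly R[m]}) : 'cV[{mpoly R[m.+1]}]_m.+1 :=
  \col_i (idmap m.+1 i 0 + (if i == ord_max then mwiden g else 0)).

Definition elementary_inv m (g : {mpoly R[m]}) : 'cV[{mpoly R[m.+1]}]_m.+1 :=
  \col_i (idmap m.+1 i 0 - (if i == ord_max then mwiden g else 0)).

(* The field obtained from x' = A x by y = phi x, where psi is the inverse of
   phi; see mxeval_change_of_variables for its values. *)
Definition change_of_variables n (phi psi : 'cV[{mpoly R[n]}]_n)
  (A : 'M[R]_n) : 'cV[{mpoly R[n]}]_n :=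
  mxcomp psi (jacobian phi) *m mxconst n A *m psi.

Lemma mxeval_mxcomp n m k l (q : 'cV[{mpoly R[n]}]_m)
    (M : 'M[{mpoly R[m]}]_(k, l)) (x : 'cV[R]_n) :
  mxeval x (mxcomp q M) = mxeval (mxeval x q) M.
Proof.
apply/matrixP => i j; rewrite !mxE comp_mpoly_meval.
by apply: meval_eq => s; rewrite tnth_mktuple mxE.
Qed.

Lemma mxeval_mxconst n k l (M : 'M[R]_(k, l)) (x : 'cV[R]_n) :
  mxeval x (mxconst n M) = M.
Proof. by apply/matrixP => i j; rewrite !mxE mevalC. Qed.

Lemma mxeval_change_of_variables n (phi psi : 'cV[{mpoly R[n]}]_n)
    (A : 'M[R]_n) (y : 'cV[R]_n) :
  mxeval y (change_of_variables phi psi A) =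
  mxeval (mxeval y psi) (jacobian phi) *m A *m mxeval y psi.
Proof.
by rewrite {1}/mxeval !map_mxM -!/(mxeval _ _) mxeval_mxcomp mxeval_mxconst.
Qed.

Lemma mxeval_linear_field n (B : 'M[R]_n) (x : 'cV[R]_n) :
  mxeval x (linear_field B) = B *m x.
Proof.
rewrite {1}/mxeval map_mxM -!/(mxeval _ _) mxeval_mxconst; congr (_ *m _).
by apply/colP => i; rewrite !mxE mevalXU.
Qed.

Lemma meval_mwiden m (g : {mpoly R[m]}) (v : 'I_m.+1 -> R) :
  meval v (mwiden g) = meval (fun i => v (widen_ord (leqnSn m) i)) g.
Proof.
rewrite /mwiden /mmap raddf_sum mevalE; apply: eq_bigr => /= u _.
rewrite mevalM mevalC; congr (_ * _); rewrite rmorph_prod /=.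
by apply: eq_bigr => i _; rewrite rmorphXn /= mevalXU.
Qed.

Lemma mxeval_elementaryK m (g : {mpoly R[m]}) :
  cancel (fun x : 'cV[R]_m.+1 => mxeval x (elementary g))
         (fun y => mxeval y (elementary_inv g)).
Proof.
move=> x; apply/colP => i; rewrite !mxE mevalB mevalXU !mxE mevalD mevalXU.
case: eqP => _; last by rewrite !meval0 addr0 subr0.
rewrite !meval_mwiden; apply/eqP; rewrite subr_eq; apply/eqP; congr (_ + _).
apply: meval_eq => j; rewrite !mxE mevalD mevalXU.
by rewrite -val_eqE /= (ltn_eqF (ltn_ord j)) meval0 addr0.
Qed.

Lemma mxeval_elementary_invK m (g : {mpoly R[m]}) :
  cancel (fun y : 'cV[R]_m.+1 => mxeval y (elementary_inv g))
         (fun x => mxeval x (elementary g)).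
Proof.
move=> x; apply/colP => i; rewrite !mxE mevalD mevalXU !mxE mevalB mevalXU.
case: eqP => _; last by rewrite !meval0 subr0 addr0.
rewrite !meval_mwiden; apply/eqP; rewrite addrAC subr_eq; apply/eqP.
congr (_ + _); apply: meval_eq => j; rewrite !mxE mevalB mevalXU.
by rewrite -val_eqE /= (ltn_eqF (ltn_ord j)) meval0 subr0.
Qed.

(* An edge from i to j has weight d f_i / d x_j. *)
Definition wdg_weight n (f : 'cV[{mpoly R[n]}]_n) (i j : 'I_n) : {mpoly R[n]} :=
  mderiv j (f i 0).

Definition wdg_edge n (f : 'cV[{mpoly R[n]}]_n) : rel 'I_n :=
  fun i j => wdg_weight f i j != 0.

(* A directed cycle is given by the list of its distinct vertices; the list
   [:: i] is the self-loop at i, and next closes the cycle up. *)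
Definition WDG_condition n (f : 'cV[{mpoly R[n]}]_n) : Prop :=
  forall c : seq 'I_n, cycle (wdg_edge f) c -> uniq c ->
    exists a : R, \prod_(i <- c) wdg_weight f i (next c i) = mpolyC n a.

End PolynomialMaps.

Section Flows.
Variable R : realType.

(* flow f x0 t y states that e^{tf} x0 is defined and equal to y: some solution
   of x' = f(x), x(0) = x0, on an open interval containing 0 and t takes the
   value y at t. *)
Definition flow n (f : 'cV[{mpoly R[n]}]_n) (x0 : 'cV[R]_n) (t : R)
  (y : 'cV[R]_n) : Prop :=
  exists (a b : R) (x : R -> 'cV[R]_n),
    [/\ a < 0 < b, a < t < b, x 0 = x0, x t = y &
     forall s : R, a < s < b -> forall i : 'I_n,
       is_derive s (1 : R) (fun u => x u i 0) (mxeval (x s) f i 0)].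

(* The projection of R^(n+k) on the first n coordinates is usubmx.  The
   equality of the two flows for all t >= 0 includes that both are defined. *)
Definition is_lift n k (f : 'cV[{mpoly R[n]}]_n) (p : 'cV[{mpoly R[n]}]_k)
  (ft : 'cV[{mpoly R[n + k]}]_(n + k)) : Prop :=
  forall (x0 : 'cV[R]_n) (t : R), 0 <= t ->
    exists z : 'cV[R]_(n + k),
      flow ft (col_mx x0 (mxeval x0 p)) t z /\ flow f x0 t (usubmx z).

Definition super_linearizable n (f : 'cV[{mpoly R[n]}]_n) : Prop :=
  exists (k : nat) (p : 'cV[{mpoly R[n]}]_k) (B : 'M[R]_(n + k)),
    is_lift f p (linear_field B).

Definition class_W n (f : 'cV[{mpoly R[n]}]_n) : Prop :=
  super_linearizable f /\ WDG_condition f.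

End Flows.

(* Main.v *)
(* A linear system x' = A x has global solutions, given by the exponential
   series.  If a field f factors as F(q(z)) through polynomials q(z) obeying a
   linear system, then the monomials of degree < b in q(z), b large, span a space
   that contains the entries of f and is stable under differentiation along f;
   adjoining them to z therefore linearizes f.  This applies to h with q the
   inverse of the elementary map phi, and, for (1), to the lift of h by the
   variable w = y_n - g(y_1, ..., y_{n-1}) = x_n: there every occurrence of
   y_n - g can be written w, so that no edge of the WDG enters v_n and all the
   edges leaving another vertex have constant weight.  Under the hypothesis of
   (2), only the self-loop at v_n, of weight a_nn, enters v_n. *)
Require Import Defs.
From HB Require Import structures.
From mathcomp Require Import all_boot all_order all_algebra.
From mathcomp Require Import boolp functions reals topology normedtype sequences derive exp.
From mathcomp Require Import -(notations) mpoly.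
Import Order.TTheory GRing.Theory Num.Theory.
Import numFieldNormedType.Exports.
(* The library file derive also defines a jacobian. *)
Import Defs.

Set Implicit Arguments.
Unset Strict Implicit.
Unset Printing Implicit Defensive.

Local Open Scope ring_scope.

(** * Global solutions of linear systems *)

Definition global_solution (R : realType) n (f : 'cV[{mpoly R[n]}]_n)
    (x : R -> 'cV[R]_n) : Prop :=
  forall (s : R) (i : 'I_n),
    is_derive s (1 : R) (fun u => x u i 0) (mxeval (x s) f i 0).

Section LinearFlow.
Variables (R : realType) (n : nat) (A : 'M[R]_n).
Implicit Types v : 'cV[R]_n.

(** The coefficient of t^k in the i-th coordinate of e^{tA} v, so that [linear_flow v t] is e^{tA}
    v. *)
Definition linear_flow_coef v (i : 'I_n) (k : nat) : R :=
  iter k (mulmx A) v i 0 / k`!%:R.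

Definition linear_flow v (t : R) : 'cV[R]_n :=
  \col_i limn (pseries (linear_flow_coef v i) t).

Lemma linear_flow_coef_mulmx v i k :
  linear_flow_coef (A *m v) i k = \sum_j A i j * linear_flow_coef v j k.
Proof.
rewrite /linear_flow_coef -iterSr iterS mxE mulr_suml.
by apply: eq_bigr => j _; rewrite mulrA.
Qed.

(** Since (k+1)/(k+1)! = 1/k!, termwise differentiation of e^{tA} v yields e^{tA} (A v). *)
Lemma pseries_diffs_linear_flow_coef v i :
  pseries_diffs (linear_flow_coef v i) = linear_flow_coef (A *m v) i.
Proof.
apply/funext => k; rewrite /pseries_diffs /linear_flow_coef -iterSr factS natrM.
by rewrite invfM mulrCA mulVKf ?pnatr_eq0.
Qed.

(** In the l1 norm, [A] multiplies lengths by at most the sum of the |a_ij|; this geometric bound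
    lets a real exponential series dominate the one for e^{tA} v. *)
Lemma iter_mulmx_sum_norm v k :
  \sum_i `|iter k (mulmx A) v i 0| <=
  (\sum_i \sum_j `|A i j|) ^+ k * \sum_i `|v i 0|.
Proof.
elim: k => [|k IHk]; first by rewrite expr0 mul1r.
rewrite exprS -mulrA iterS; set w := iter k _ v in IHk *.
apply: (@le_trans _ _ ((\sum_i \sum_j `|A i j|) * \sum_i `|w i 0|)).
  rewrite mulr_suml ler_sum// => i _; rewrite mxE mulr_suml.
  apply: (le_trans (ler_norm_sum _ _ _)); rewrite ler_sum// => j _.
  by rewrite normrM ler_wpM2l// (bigD1 j)//= lerDl sumr_ge0.
by rewrite ler_wpM2l// sumr_ge0// => i _; rewrite sumr_ge0.
Qed.

Lemma is_cvg_linear_flow v i t : cvgn (pseries (linear_flow_coef v i) t).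
Proof.
set C := \sum_i \sum_j `|A i j|; set D := \sum_i `|v i 0|.
have C0 : 0 <= C by rewrite sumr_ge0// => k _; rewrite sumr_ge0.
have D0 : 0 <= D by rewrite sumr_ge0.
apply: normed_cvg; apply: (@series_le_cvg _ _ (D *: exp_coeff (C * `|t|))).
- by move=> k; rewrite normr_ge0.
- by move=> k; rewrite /= mulr_ge0// divr_ge0// exprn_ge0// mulr_ge0.
- move=> k; rewrite /= !normrM normfV normrX.
  have -> : (D *: exp_coeff (C * `|t|)) k = C ^+ k * D / k`!%:R * `|t| ^+ k.
    rewrite -[LHS]/(D * ((C * `|t|) ^+ k / k`!%:R)) exprMn.
    by rewrite mulrA [RHS]mulrAC mulrCA mulrA.
  rewrite ler_wpM2r ?exprn_ge0// [`|k`!%:R|]ger0_norm// ler_wpM2r ?invr_ge0//.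
  apply: le_trans (iter_mulmx_sum_norm v k).
  by rewrite (bigD1 i)//= lerDl sumr_ge0.
- by apply: is_cvg_seriesZ; exact: is_cvg_series_exp_coeff.
Qed.

Lemma linear_flow0 v : linear_flow v 0 = v.
Proof.
apply/colP => i; rewrite mxE; apply: lim_near_cst => //.
(* Equality holds only eventually: the empty partial sum, at k = 0, is zero. *)
near=> k; rewrite /pseries /series /= -[k]prednK; last by near: k; exists 1%N.
rewrite big_nat_recl//= big1 ?addr0 => [|j _]; last by rewrite expr0n mulr0.
by rewrite /linear_flow_coef /= fact0 divr1 expr0 mulr1.
Unshelve. all: by end_near.
Qed.

Lemma linear_flow_mulmx v t : linear_flow (A *m v) t = A *m linear_flow v t.
Proof.
apply/colP => i; rewrite !mxE; apply: cvg_lim => //.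
have -> : pseries (linear_flow_coef (A *m v) i) t =
    (fun k => \sum_j A i j * pseries (linear_flow_coef v j) t k).
  apply/funext => k; rewrite /pseries /series /=.
  under [RHS]eq_bigr do rewrite mulr_sumr.
  rewrite exchange_big; apply: eq_bigr => l _.
  rewrite linear_flow_coef_mulmx mulr_suml.
  by apply: eq_bigr => j _; rewrite mulrA.
apply: cvg_big => [|j _]; first by apply: add_continuous.
rewrite mxE; apply: cvgMl_tmp.
exact: is_cvg_linear_flow.
Qed.

Lemma linear_flowP v : global_solution (linear_field A) (linear_flow v).
Proof.
move=> t i; rewrite mxeval_linear_field -linear_flow_mulmx mxE.
rewrite -pseries_diffs_linear_flow_coef.
under [X in is_derive _ _ X _]funext => t0 do rewrite mxE.
(* The series converge everywhere, so any point beyond |t| serves here. *)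
apply: (@pseries_snd_diffs _ _ (`|t| + 1)).
- exact: is_cvg_linear_flow.
- by rewrite pseries_diffs_linear_flow_coef; exact: is_cvg_linear_flow.
- by rewrite !pseries_diffs_linear_flow_coef; exact: is_cvg_linear_flow.
- by rewrite [ltRHS]ger0_norm ?addr_ge0// ltrDl.
Qed.

End LinearFlow.

(** * Calculus of polynomial maps along solutions *)

(** Monomials are products of variables, so the chain rules below need checking only on constants,
    variables, sums and products. *)
Lemma mpoly_ring_ind (R : nzRingType) n (P : {mpoly R[n]} -> Prop) :
  (forall c, P (mpolyC n c)) -> (forall i, P (mpolyX R (mnm1 i))) ->
  (forall p q, P p -> P q -> P (p + q)) ->
  (forall p q, P p -> P q -> P (p * q)) -> forall p, P p.
Proof.
move=> PC PX PD PM; elim/mpolyind => [|c m p _ _ Pp]; first by rewrite -mpolyC0.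
apply: PD => //; rewrite -mul_mpolyC; apply: (PM) => //.
rewrite mpolyXE_id; apply: big_rec => [|i r _ Pr]; first by rewrite -mpolyC1.
apply: (PM) => //; elim: (m i) => [|k IHk]; first by rewrite expr0 -mpolyC1.
by rewrite exprS; exact: PM.
Qed.

Lemma mderiv_var (R : nzRingType) n (i j : 'I_n) :
  mderiv i (mpolyX R (mnm1 j)) = mpolyC n (i == j)%:R.
Proof.
rewrite mderivX mnm1E eq_sym; case: eqP => [->|_]; last by rewrite scale0r mpolyC0.
by rewrite -{1}[mnm1 j]add0m addmK mpolyX0 scale1r mpolyC1.
Qed.

Lemma mderiv_comp_mpoly (R : comNzRingType) n k (t : n.-tuple {mpoly R[k]})
    (p : {mpoly R[n]}) j :
  mderiv j (comp_mpoly t p) =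
  \sum_i comp_mpoly t (mderiv i p) * mderiv j (tnth t i).
Proof.
elim/mpoly_ring_ind: p => [c|i|p q Ep Eq|p q Ep Eq].
- rewrite comp_mpolyC mderivC big1// => i _.
  by rewrite mderivC raddf0 mul0r.
- rewrite comp_mpolyXU -tnth_nth (bigD1 i)//= mderiv_var eqxx comp_mpolyC mpolyC1.
  rewrite mul1r big1 ?addr0// => l /negPf li.
  by rewrite mderiv_var li comp_mpolyC mpolyC0 mul0r.
- rewrite raddfD mderivD Ep Eq -big_split; apply: eq_bigr => i _.
  by rewrite mderivD raddfD mulrDl.
- rewrite rmorphM mderivM Ep Eq mulr_suml mulr_sumr -big_split.
  apply: eq_bigr => i _; rewrite mderivM rmorphD !rmorphM/= mulrDl.
  by rewrite mulrAC mulrA.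
Qed.

Lemma jacobian_mxcomp (R : comNzRingType) n m k (q : 'cV[{mpoly R[n]}]_m)
    (p : 'cV[{mpoly R[m]}]_k) :
  jacobian (mxcomp q p) = mxcomp q (jacobian p) *m jacobian q.
Proof.
apply/matrixP => i j; rewrite !mxE mderiv_comp_mpoly; apply: eq_bigr => l _.
by rewrite !mxE tnth_mktuple.
Qed.

Lemma mxevalM (R : comNzRingType) n k l r (x : 'cV[R]_n)
    (M : 'M[{mpoly R[n]}]_(k, l)) (N : 'M[{mpoly R[n]}]_(l, r)) :
  mxeval x (M *m N) = mxeval x M *m mxeval x N.
Proof. exact: map_mxM. Qed.

(** The derivative is the Lie derivative of [P] along [f]. Both sides obey the sum and Leibniz
    rules, and for a variable the claim is the differential equation itself. *)
Lemma is_derive_mxeval (R : realType) n k (f : 'cV[{mpoly R[n]}]_n)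
    (P : 'cV[{mpoly R[n]}]_k) (x : R -> 'cV[R]_n) (s : R) (i : 'I_k) :
  global_solution f x ->
  is_derive s (1 : R) (fun u => mxeval (x u) P i 0)
    (mxeval (x s) (jacobian P *m f) i 0).
Proof.
move=> fx; rewrite mxevalM mxE.
under eq_bigr do rewrite [mxeval _ _ _ _]mxE [jacobian _ _ _]mxE.
under [X in is_derive _ _ X _]funext => u do rewrite mxE.
elim/mpoly_ring_ind: (P i 0) => [c|j|p q Ep Eq|p q Ep Eq].
- under [X in is_derive _ _ X _]funext => u do rewrite mevalC.
  by rewrite big1 => [|j _]; [exact: is_derive_cst|rewrite mderivC meval0 mul0r].
- under [X in is_derive _ _ X _]funext => u do rewrite mevalXU.
  rewrite (bigD1 j)//= mderiv_var eqxx mevalC mul1r big1 ?addr0 => [|l /negPf lj].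
    exact: fx.
  by rewrite mderiv_var lj mevalC mul0r.
- under [X in is_derive _ _ X _]funext => u do rewrite mevalD.
  under eq_bigr do rewrite mderivD mevalD mulrDl.
  by rewrite big_split; exact: is_deriveD.
- under [X in is_derive _ _ X _]funext => u do rewrite mevalM.
  apply: (is_derive_eq (is_deriveM Ep Eq)).
  rewrite addrC ![_ *: \sum_i _]mulr_sumr -big_split; apply: eq_bigr => j _.
  by rewrite mderivM mevalD !mevalM mulrDl !mulrA [X in X * _ + _]mulrC.
Qed.

Lemma flow_global_solution (R : realType) n (f : 'cV[{mpoly R[n]}]_n)
    (x : R -> 'cV[R]_n) t :
  global_solution f x -> flow f (x 0) t (x t).
Proof.
move=> fx; exists (- (`|t| + 1)), (`|t| + 1), x.
have t1 : 0 < `|t| + 1 by rewrite ltr_wpDl.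
have tt : `|t| < `|t| + 1 by rewrite ltrDl.
split=> //; first by rewrite oppr_lt0 t1.
by rewrite -ltr_norml.
Qed.

(** * Super-linearization by monomials *)

Section Superlinearization.
Variable R : realType.

Definition monomials n b : 'cV[{mpoly R[n]}]_#|{: bmultinom n b}| :=
  \col_i mpolyX R (bmnm (enum_val i)).

Lemma monomials_span n b k (P : 'cV[{mpoly R[n]}]_k) :
  (forall i, (msize (P i ord0) <= b)%N) ->
  exists C : 'M[R]_(k, _), P = mxconst n C *m monomials n b.
Proof.
move=> Pb; exists (\matrix_(i, j) mcoeff (bmnm (enum_val j)) (P i 0)).
apply/colP => i; rewrite [LHS](mpolywE (Pb i)) (reindex_onto enum_val enum_rank) => /=.
  rewrite mxE; apply: eq_big => [j|j _]; first by rewrite enum_valK eqxx.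
  by rewrite !mxE mul_mpolyC.
by move=> j _; rewrite enum_rankK.
Qed.

(** A partial derivative lowers the degree of a monomial by one and the linear entry multiplied in
    restores it, so the span of [monomials n b] is stable under the Lie derivative. *)
Lemma msize_lie_monomials n b (A : 'M[R]_n) i :
  (msize ((jacobian (monomials n b) *m linear_field A)%R i ord0) <= b)%N.
Proof.
rewrite mxE; apply: (leq_trans (msize_sum _ _ _)); apply/bigmax_leqP => j _.
rewrite !mxE mderivX; set u := bmnm _.
have ub : (mdeg u < b)%N by exact: bmdeg.
(* When u_j = 0 the subtraction u - e_j truncates and keeps the degree; the coefficient u_j kills
   the term. *)
have [->|uj] := eqVneq (u j) 0%N; first by rewrite scale0r mul0r msize0.
rewrite mulr_sumr; apply: (leq_trans (msize_sum _ _ _)); apply/bigmax_leqP => k _.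
rewrite !mxE -scalerAl mulrCA mul_mpolyC -mpolyXD.
do 2!rewrite (leq_trans (msizeZ_le _ _))//.
rewrite msizeX mdegD mdeg1 -(mdeg1 j) -mdegD.
by rewrite submK ?lep1mP.
Qed.

(** One solution from each starting point suffices, since [flow] asks only for existence; taking it
    global covers every t. *)
Lemma super_linearizable_factor N n (f : 'cV[{mpoly R[N]}]_N)
    (q : 'cV[{mpoly R[N]}]_n) (F : 'cV[{mpoly R[n]}]_N) (A : 'M[R]_n) :
  f = mxcomp q F ->
  (forall z0, exists z : R -> 'cV[R]_N, [/\ z 0 = z0, global_solution f z &
     global_solution (linear_field A) (fun t => mxeval (z t) q)]) ->
  super_linearizable f.
Proof.
move=> fE fsol; pose b := \max_i msize (F i ord0).
have [C FE] : exists C, F = mxconst n C *m monomials n b.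
  by apply: monomials_span => i; exact: (leq_bigmax (F := fun i => msize (F i ord0))).
have [E ME] := monomials_span (@msize_lie_monomials n b A).
(* [C] expresses f, and [E] the derivative of the monomials, through the monomials in q(z); z itself
   does not occur on the right, hence the zero blocks. *)
exists _, (mxcomp q (monomials n b)), (block_mx 0 C 0 E) => z0 t _.
have [z [z00 fz qz]] := fsol z0.
pose y u := col_mx (z u) (mxeval (z u) (mxcomp q (monomials n b))).
exists (y t); rewrite -z00; split; last first.
  by rewrite col_mxKu; exact: flow_global_solution.
apply: (flow_global_solution (x := y)) => s i; rewrite mxeval_linear_field.
rewrite mul_block_col !mul0mx !add0r mxeval_mxcomp.
case: (split_ordP i) => j ->.
  under [X in is_derive _ _ X _]funext => u do rewrite col_mxEu.
  rewrite col_mxEu -{1}(mxeval_mxconst C (mxeval (z s) q)) -mxevalM -FE.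
  by rewrite -mxeval_mxcomp -fE; exact: fz.
under [X in is_derive _ _ X _]funext => u do rewrite col_mxEd mxeval_mxcomp.
rewrite col_mxEd -{1}(mxeval_mxconst E (mxeval (z s) q)) -mxevalM -ME.
exact: is_derive_mxeval.
Qed.

End Superlinearization.

(* No cycle reaches v except through its self-loop. *)
Lemma WDG_condition_from_vertex (R : comNzRingType) n
    (f : 'cV[{mpoly R[n]}]_n) (v : 'I_n) :
  (forall i, i != v -> wdg_weight f i v = 0) ->
  (forall i j, i != v -> exists a, wdg_weight f i j = mpolyC n a) ->
  (exists a, wdg_weight f v v = mpolyC n a) ->
  WDG_condition f.
Proof.
move=> fv fc fvv c ce cu.
have next_v : v \in c -> next c v = v.
  move=> vc; suff pv : prev c v = v by rewrite -{1}pv next_prev.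
  (* An edge into [v] from another vertex would have weight zero. *)
  apply/eqP; apply: contraT => pv.
  have pc : prev c v \in c by rewrite mem_prev.
  by have := next_cycle ce pc; rewrite next_prev// /wdg_edge fv ?eqxx.
(* The cycle can leave [v] only by its self-loop, so every factor is constant. *)
rewrite big_seq; elim/big_rec: _ => [|i w ic [b ->]]; first by exists 1; rewrite mpolyC1.
suff [a ->] : exists a, wdg_weight f i (next c i) = mpolyC n a.
  by exists (a * b); rewrite mpolyCM.
by have [iv|/fc//] := eqVneq i v; rewrite iv next_v// -iv.
Qed.

(** * Linear systems after a change of variables *)

Lemma mxcompM (R : comNzRingType) n m k l r (q : 'cV[{mpoly R[n]}]_m)
    (M : 'M[{mpoly R[m]}]_(k, l)) (N : 'M[{mpoly R[m]}]_(l, r)) :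
  mxcomp q (M *m N) = mxcomp q M *m mxcomp q N.
Proof. exact: map_mxM. Qed.

Lemma mxcomp_linear_field (R : comNzRingType) n m (q : 'cV[{mpoly R[n]}]_m)
    (A : 'M[R]_m) :
  mxcomp q (linear_field A) = mxconst n A *m q.
Proof.
rewrite mxcompM; congr (_ *m _); apply/matrixP => i j.
  by rewrite !mxE comp_mpolyC.
by rewrite !mxE comp_mpolyXU -tnth_nth tnth_mktuple ord1.
Qed.

Lemma mderiv_mxconst_mul (R : comNzRingType) n k l (A : 'M[R]_(k, l))
    (q : 'cV[{mpoly R[n]}]_l) i j :
  mderiv j ((mxconst n A *m q) i 0) = \sum_s A i s *: mderiv j (q s 0).
Proof.
rewrite mxE raddf_sum; apply: eq_bigr => s _.
by rewrite /= mxE mderiv_mulC mul_mpolyC.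
Qed.

Lemma mulmx_delta_row (R : pzRingType) n k (M : 'M[R]_(k, n)) (N : 'cV[R]_n) i j :
  (forall l, M i l = (l == j)%:R) -> (M *m N) i 0 = N j 0.
Proof.
move=> Mi; rewrite mxE (bigD1 j)//= Mi eqxx mul1r big1 ?addr0// => l /negPf lj.
by rewrite Mi lj mul0r.
Qed.

Section ChangeOfVariables.
Variables (R : realType) (n : nat) (phi psi : 'cV[{mpoly R[n]}]_n) (A : 'M[R]_n).
Hypothesis phiK :
  cancel (fun x : 'cV[R]_n => mxeval x phi) (fun y => mxeval y psi).

(** Writes the field as F(psi(y)) with F(x) = D phi_x A x, the factorization needed to linearize
    it. *)
Lemma change_of_variablesE :
  change_of_variables phi psi A = mxcomp psi (jacobian phi *m linear_field A).
Proof. by rewrite mxcompM mxcomp_linear_field mulmxA. Qed.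

Lemma global_solution_change_of_variables x :
  global_solution (linear_field A) x ->
  global_solution (change_of_variables phi psi A) (fun t => mxeval (x t) phi).
Proof.
move=> Ax s i; rewrite change_of_variablesE mxeval_mxcomp phiK.
exact: is_derive_mxeval.
Qed.

Hypothesis psiK :
  cancel (fun y : 'cV[R]_n => mxeval y psi) (fun x => mxeval x phi).

Lemma super_linearizable_change_of_variables :
  super_linearizable (change_of_variables phi psi A).
Proof.
apply: (super_linearizable_factor (A := A) change_of_variablesE) => z0.
have Ax := linear_flowP A (mxeval z0 psi).
(* From [z0] the solution is phi(e^{tA} psi(z0)), along which psi follows the linear flow. *)
exists (fun t => mxeval (linear_flow A (mxeval z0 psi) t) phi); split.
- by rewrite linear_flow0 psiK.
- exact: global_solution_change_of_variables.
- by under [X in global_solution _ X]funext => t do rewrite phiK.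
Qed.

End ChangeOfVariables.

(** * Elementary transformations and the lift by one variable *)

Section Elementary.
Variables (R : realType) (m : nat) (A : 'M[R]_m.+1) (g : {mpoly R[m]}).

Lemma mderiv_ord_max_mwiden : mderiv ord_max (mwiden g) = 0.
Proof.
elim/mpoly_ring_ind: g => [c|i|p q p0 q0|p q p0 q0].
- by rewrite mwidenC mderivC.
- by rewrite mwidenX mnmwiden1 mderiv_var -val_eqE/= gtn_eqF// mpolyC0.
- by rewrite mwidenD mderivD p0 q0 addr0.
- by rewrite mwidenM mderivM p0 q0 mul0r mulr0 addr0.
Qed.

Lemma jacobian_elementary i j :
  jacobian (elementary g) i j =
  (j == i)%:R + (if i == ord_max then mderiv j (mwiden g) else 0).
Proof.
rewrite !mxE mderivD mderiv_var mpolyC_nat.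
by case: (i == _); rewrite ?mderiv0.
Qed.

Lemma mderiv_elementary_inv i j :
  mderiv j (elementary_inv g i 0) =
  (j == i)%:R - (if i == ord_max then mderiv j (mwiden g) else 0).
Proof.
rewrite !mxE mderivB mderiv_var mpolyC_nat.
by case: (i == _); rewrite ?mderiv0.
Qed.

(** As a_in = 0 for i != n, the term y_n - g drops out of the first n-1 entries, which become linear
    in y_1, ..., y_{n-1}; the last entry contains y_n only through a_nn (y_n - g). *)
Lemma WDG_condition_elementary :
  (forall i, i != ord_max -> A i ord_max = 0) ->
  WDG_condition (change_of_variables (elementary g) (elementary_inv g) A).
Proof.
set psi := elementary_inv g => A0; set L := mxconst m.+1 A *m psi.
have hE : change_of_variables (elementary g) psi A =
    mxcomp psi (jacobian (elementary g)) *m L by rewrite /L mulmxA.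
have dmax i : mderiv ord_max (psi i 0) = (ord_max == i)%:R.
  by rewrite mderiv_elementary_inv mderiv_ord_max_mwiden if_same subr0.
have Lmax i : mderiv ord_max (L i 0) = mpolyC _ (A i ord_max).
  rewrite mderiv_mxconst_mul (bigD1 ord_max)//= dmax eqxx big1 => [|j /negPf jm].
    by rewrite addr0 -mul_mpolyC mulr1.
  by rewrite dmax eq_sym jm scaler0.
have hi i : i != ord_max -> change_of_variables (elementary g) psi A i 0 = L i 0.
  move=> /negPf im; rewrite hE; apply: mulmx_delta_row => l.
  by rewrite mxE jacobian_elementary im addr0 rmorph_nat.
apply: (WDG_condition_from_vertex (v := ord_max)).
- by move=> i im; rewrite /wdg_weight hi// Lmax A0.
- move=> i j im; exists (\sum_s A i s * (j == s)%:R).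
  rewrite /wdg_weight hi// mderiv_mxconst_mul raddf_sum; apply: eq_bigr => s _ /=.
  have [->|/negPf sm] := eqVneq s ord_max; first by rewrite A0// scale0r mul0r mpolyC0.
  by rewrite mderiv_elementary_inv sm subr0 mpolyCM mul_mpolyC mpolyC_nat.
- exists (A ord_max ord_max); rewrite /wdg_weight hE mxE.
  rewrite raddf_sum /= (bigD1 ord_max)//= big1 => [|j /negPf jm]; last first.
    rewrite mderivM Lmax A0 ?jm// mpolyC0 mulr0 addr0.
    rewrite mxE mderiv_comp_mpoly big1 ?mul0r// => i _.
    rewrite tnth_mktuple dmax jacobian_elementary jm eqxx add0r.
    have [<-|_] := eqVneq ord_max i; last by rewrite mulr0.
    (* The coefficient is a partial derivative of g, seen to be free of the last variable by
       swapping the two derivatives. *)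
    by rewrite mderiv_comm mderiv_ord_max_mwiden mderiv0 raddf0 mul0r.
  rewrite mxE jacobian_elementary !eqxx mderiv_ord_max_mwiden !addr0 rmorph_nat mul1r.
  exact: Lmax.
Qed.

(* In R^(n+1) the coordinate y_n has index lshift 1 ord_max, and w has index
   rshift m.+1 0; lift_source is (y, w) |-> (y_1, ..., y_{n-1}, w), which is the
   original variable x along the lift, and lift_target is x |-> (phi x, x_n). *)
Definition lift_slot (i : 'I_m.+1) : 'I_(m.+1 + 1) :=
  if i == ord_max then rshift m.+1 0 else lshift 1 i.

Definition lift_source : 'cV[{mpoly R[m.+1 + 1]}]_m.+1 :=
  \col_i mpolyX R (mnm1 (lift_slot i)).

Definition lift_target : 'cV[{mpoly R[m.+1]}]_(m.+1 + 1) :=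
  col_mx (elementary g) (const_mx (mpolyX R (mnm1 ord_max))).

(** The push-forward of A x by [lift_target], extended off its image as a function of y_1, ...,
    y_{n-1} and w alone. *)
Definition elementary_lift : 'cV[{mpoly R[m.+1 + 1]}]_(m.+1 + 1) :=
  mxcomp lift_source (jacobian lift_target *m linear_field A).

Lemma mxeval_lift_source z i : mxeval z lift_source i 0 = z (lift_slot i) 0.
Proof. by rewrite !mxE mevalXU. Qed.

Lemma mxeval_lift_target x :
  mxeval x lift_target =
  col_mx (mxeval x (elementary g)) (const_mx (x ord_max 0)).
Proof.
apply/colP => i; rewrite mxE; case: (split_ordP i) => j ->.
  by rewrite !col_mxEu [RHS]mxE.
by rewrite !col_mxEd !mxE mevalXU.
Qed.

Lemma mxeval_elementary x i :
  i != ord_max -> mxeval x (elementary g) i 0 = x i 0.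
Proof. by move=> /negPf im; rewrite !mxE im addr0 mevalXU. Qed.

(* A solution of the lift keeps y_n - g(y_1, ..., y_{n-1}) - w constant; a is the
   value of this invariant, nonzero off the graph of p. *)
Lemma lift_targetK x a :
  mxeval (mxeval x lift_target + a *: delta_mx (lshift 1 ord_max) 0) lift_source
  = x.
Proof.
apply/colP => i; rewrite mxeval_lift_source mxeval_lift_target /lift_slot.
have [->|im] := eqVneq i ord_max.
  by rewrite mxE col_mxEd !mxE eq_rlshift mulr0 addr0.
rewrite mxE col_mxEu mxeval_elementary// !mxE eq_lshift (negPf im).
by rewrite mulr0 addr0.
Qed.

(** The field does not involve y_n, so its solutions may be translated in that direction. *)
Lemma global_solution_elementary_lift x a :
  global_solution (linear_field A) x ->
  global_solution elementary_lift
    (fun t => mxeval (x t) lift_target + a *: delta_mx (lshift 1 ord_max) 0).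
Proof.
move=> Ax s i; rewrite mxeval_mxcomp lift_targetK.
under [X in is_derive _ _ X _]funext => u do rewrite mxE.
rewrite -[X in is_derive _ _ _ X]addr0; apply: is_deriveD.
exact: is_derive_mxeval.
Qed.

(** The starting point (x0, p(x0)) is the image of psi(x0) under [lift_target], so both flows come
    from the single curve e^{tA} psi(x0). *)
Lemma elementary_liftP :
  is_lift (change_of_variables (elementary g) (elementary_inv g) A)
    (const_mx (elementary_inv g ord_max 0)) elementary_lift.
Proof.
move=> x0 t _; set xi := mxeval x0 (elementary_inv g).
have Ax := linear_flowP A xi.
have := global_solution_elementary_lift 0 Ax; rewrite scale0r.
under [X in global_solution _ X]funext => u do rewrite addr0.
move=> hz; exists (mxeval (linear_flow A xi t) lift_target); split.
  have -> : col_mx x0 (mxeval x0 (const_mx (elementary_inv g ord_max 0))) =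
      mxeval (linear_flow A xi 0) lift_target.
    rewrite linear_flow0 mxeval_lift_target mxeval_elementary_invK.
    by congr col_mx; apply/colP => i; rewrite !mxE.
  exact: (flow_global_solution t hz).
rewrite mxeval_lift_target col_mxKu.
have hx := global_solution_change_of_variables (mxeval_elementaryK g) Ax.
have := flow_global_solution t hx.
by rewrite linear_flow0 mxeval_elementary_invK.
Qed.

Lemma super_linearizable_elementary_lift : super_linearizable elementary_lift.
Proof.
apply: (super_linearizable_factor (A := A) (q := lift_source) erefl) => z0.
set x0 := mxeval z0 lift_source; have Ax := linear_flowP A x0.
set v := lshift 1 (ord_max : 'I_m.+1).
(* [z0] and the image of [x0] under [lift_target] can differ only in the coordinate y_n; [a] is
   their gap there. *)
pose a := z0 v 0 - mxeval x0 lift_target v 0.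
exists (fun t => mxeval (linear_flow A x0 t) lift_target + a *: delta_mx v 0).
split; last by under [X in global_solution _ X]funext => t do rewrite lift_targetK.
  apply/colP => i; rewrite linear_flow0 mxE [X in _ + X]mxE [delta_mx _ _ _ _]mxE.
  have [->|iv] := eqVneq i v; first by rewrite mulr1 addrCA subrr addr0.
  rewrite mulr0 addr0 mxeval_lift_target.
  case: (split_ordP i) iv => j -> jv.
    have jm : j != ord_max by rewrite -(eq_lshift 1).
    by rewrite col_mxEu mxeval_elementary// mxeval_lift_source /lift_slot (negPf jm).
  by rewrite col_mxEd mxE mxeval_lift_source /lift_slot eqxx (ord1 j).
exact: global_solution_elementary_lift.
Qed.

Lemma WDG_condition_elementary_lift : WDG_condition elementary_lift.
Proof.
set v := lshift 1 (ord_max : 'I_m.+1).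
have slotv i : (v == lift_slot i) = false.
  rewrite /lift_slot; case: (eqVneq i ord_max) => im; first by rewrite eq_lrshift.
  by rewrite eq_lshift eq_sym (negPf im).
have wv i : wdg_weight elementary_lift i v = 0.
  rewrite /wdg_weight mxE mderiv_comp_mpoly big1// => j _.
  by rewrite tnth_mktuple [lift_source _ _]mxE mderiv_var slotv mpolyC0 mulr0.
apply: (WDG_condition_from_vertex (v := v)) => [//|i j iv|]; last first.
  by exists 0; rewrite wv mpolyC0.
(* Off [v], each entry of [lift_target] is a coordinate x_k, with k = i for y_i and k = n for w, so
   the field there is a row of A x. *)
have [k hk] : exists k, elementary_lift i 0 =
    (mxconst _ A *m lift_source) k 0.
  have [k hk] : exists k, forall l, jacobian lift_target i l = (l == k)%:R.
    case: (split_ordP i) iv => k -> kv.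
      exists k => l; rewrite mxE col_mxEu.
      have := jacobian_elementary k l; rewrite mxE => ->.
      suff /negPf-> : k != ord_max by rewrite addr0.
      by rewrite -(eq_lshift 1).
    by exists ord_max => l; rewrite mxE col_mxEd mxE mderiv_var mpolyC_nat.
  by exists k; rewrite mxE (mulmx_delta_row _ hk) -mxcomp_linear_field [RHS]mxE.
exists (\sum_s A k s * (j == lift_slot s)%:R).
rewrite /wdg_weight hk mderiv_mxconst_mul raddf_sum; apply: eq_bigr => s _ /=.
by rewrite mxE mderiv_var mpolyCM mul_mpolyC.
Qed.

End Elementary.

Theorem proposition3p3 (R : realType) (m : nat) (A : 'M[R]_m.+1)
    (g : {mpoly R[m]}) (hg : (1 < mdegree g)%N) :
  let h := change_of_variables (elementary g) (elementary_inv g) A in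
  (exists (p : 'cV[{mpoly R[m.+1]}]_1)
          (ht : 'cV[{mpoly R[m.+1 + 1]}]_(m.+1 + 1)),
      is_lift h p ht /\ class_W ht) /\
  ((forall i : 'I_m.+1, i != ord_max -> A i ord_max = 0) -> class_W h).
Proof.
move=> h; split=> [|A0].
  exists (const_mx (elementary_inv g ord_max 0)), (elementary_lift A g); split.
    exact: elementary_liftP.
  split; first exact: super_linearizable_elementary_lift.
  exact: WDG_condition_elementary_lift.
split; last exact: WDG_condition_elementary.
apply: super_linearizable_change_of_variables.
  exact: mxeval_elementaryK.
exact: mxeval_elementary_invK.
Qed.
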